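(* Let $A$ be a set of actions containing $\tau$ and $(S,\to)$ a labelled transition system with labels from $A$. Then $\equiv_c^{\Delta}\;=\;\simeq_{D}$ as relations on $S$ (both defined in the context).
   Context: $s\xrightarrow{a}s'$ means $(s,a,s')\in\to$; $s\xrightarrow{(a)}s'$ means ''$s\xrightarrow{a}s'$, or ($a=\tau$ and $s=s'$)''; $\twoheadrightarrow$ is the reflexive–transitive closure of $\xrightarrow{\tau}$; $\omega=\{0,1,\dots\}$. A path from $s$ is a sequence $s_0,a_1,s_1,\dots,a_n,s_n$ with $s_0=s$ and $s_{k-1}\xrightarrow{a_k}s_k$. A colouring is an equivalence relation $\mathcal C$ on $S$; $\mathcal C(s)$ is the class of $s$. For a path $\pi=s_0,a_1,\dots,a_n,s_n$, $\mathcal C(\pi)$ is obtained from $\mathcal C(s_0),a_1,\mathcal C(s_1),\dots,a_n,\mathcal C(s_n)$ by contracting every subsequence of the form $C,\tau,C,\tau,\dots,\tau,C$ to $C$; it is a $\mathcal C$-coloured trace of $s_0$. $\mathcal C$ is consistent if any two states of the same colour have the same $\mathcal C$-coloured traces. A state $s$ is $\mathcal C$-divergent if there is an infinite sequence $(s_k)_{k\in\omega}$ with $s=s_0$, $s_k\xrightarrow{\tau}s_{k+1}$ and $\mathcal C(s_k)=\mathcal C(s)$ for all $k$. A consistent colouring preserves divergence if no $\mathcal C$-divergent state has the same colour as a state that is not $\mathcal C$-divergent. $s\equiv_c^{\Delta}t$ iff there is a consistent, divergence preserving colouring $\mathcal C$ with $\mathcal C(s)=\mathcal C(t)$. A symmetric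 relation $R$ on $S$ is a branching bisimulation with explicit divergence if (T) whenever $sRt$ and $s\xrightarrow{a}s'$, there are $t'',t'$ with $t\twoheadrightarrow t''\xrightarrow{(a)}t'$, $sRt''$, $s'Rt'$; and (D) whenever $sRt$ and $(s_k)_{k\in\omega}$ satisfies $s=s_0$, $s_k\xrightarrow{\tau}s_{k+1}$, $s_kRt$ for all $k$, there is $(t_\ell)_{\ell\in\omega}$ with $t=t_0$, $t_\ell\xrightarrow{\tau}t_{\ell+1}$ for all $\ell$ and $s_kRt_\ell$ for all $k,\ell$. $s\simeq_D t$ iff some such $R$ has $sRt$. *)

(* Defs.v *)
From Stdlib Require Import List Relations ClassicalEpsilon.
Import ListNotations.

Set Implicit Arguments.
Unset Strict Implicit.

Section LTS.

Variables (A S : Type) (tau : A) (step : S -> A -> S -> Prop).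

Definition opt_step (s : S) (a : A) (s' : S) : Prop :=
  step s a s' \/ (a = tau /\ s = s').

Definition tau_steps : S -> S -> Prop :=
  clos_refl_trans S (fun s s' => step s tau s').

(* The alternating sequence s0, a1, s1, ..., an, sn is stored as s0 together
   with the list [(a1, s1); ...; (an, sn)]. *)
Fixpoint is_path (s : S) (p : list (A * S)) : Prop :=
  match p with
  | [] => True
  | (a, s') :: p' => step s a s' /\ is_path s' p'
  end.

Definition colouring (C : S -> S -> Prop) : Prop := equivalence S C.

Definition colour (C : S -> S -> Prop) (s : S) : S -> Prop := fun t => C s t.

(* [contract c w] contracts c, a1, c1, ..., an, cn (c being the head colour, kept
   outside the list): a pair (tau, d) is dropped exactly when d is the colour
   immediately preceding it. *)
Fixpoint contract (c : S -> Prop) (w : list (A * (S -> Prop))) :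
    list (A * (S -> Prop)) :=
  match w with
  | [] => []
  | (a, d) :: w' =>
      if excluded_middle_informative (a = tau /\ d = c)
      then contract c w'
      else (a, d) :: contract d w'
  end.

Definition coloured_path (C : S -> S -> Prop) (s : S) (p : list (A * S)) :
    (S -> Prop) * list (A * (S -> Prop)) :=
  (colour C s,
   contract (colour C s) (map (fun x => (fst x, colour C (snd x))) p)).

Definition coloured_trace (C : S -> S -> Prop) (s : S)
    (sigma : (S -> Prop) * list (A * (S -> Prop))) : Prop :=
  exists p, is_path s p /\ sigma = coloured_path C s p.

Definition consistent (C : S -> S -> Prop) : Prop :=
  forall s t, colour C s = colour C t ->
    forall sigma, coloured_trace C s sigma <-> coloured_trace C t sigma.

Definition divergent (C : S -> S -> Prop) (s : S) : Prop :=
  exists f : nat -> S,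
    s = f 0 /\
    (forall k, step (f k) tau (f (k + 1))) /\
    (forall k, colour C (f k) = colour C s).

Definition preserves_divergence (C : S -> S -> Prop) : Prop :=
  ~ exists s t, divergent C s /\ ~ divergent C t /\ colour C s = colour C t.

Definition coloured_equiv (s t : S) : Prop :=
  exists C : S -> S -> Prop,
    colouring C /\ consistent C /\ preserves_divergence C /\
    colour C s = colour C t.

Definition transfer (R : S -> S -> Prop) : Prop :=
  forall s t a s', R s t -> step s a s' ->
    exists t'' t', tau_steps t t'' /\ opt_step t'' a t' /\ R s t'' /\ R s' t'.

Definition divergence_transfer (R : S -> S -> Prop) : Prop :=
  forall s t (f : nat -> S), R s t ->
    s = f 0 ->
    (forall k, step (f k) tau (f (k + 1))) ->
    (forall k, R (f k) t) ->
    exists g : nat -> S,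
      t = g 0 /\
      (forall l, step (g l) tau (g (l + 1))) /\
      (forall k l, R (f k) (g l)).

Definition branching_bisim_div (R : S -> S -> Prop) : Prop :=
  symmetric S R /\ transfer R /\ divergence_transfer R.

Definition branching_bisimilar_div (s t : S) : Prop :=
  exists R : S -> S -> Prop, branching_bisim_div R /\ R s t.

End LTS.

(* Main.v *)
From Stdlib Require Import List Relations Arith Classical ClassicalEpsilon
  FunctionalExtensionality PropExtensionality.
Require Import Defs.
Import ListNotations.

(** A consistent, divergence preserving colouring is itself a branching
    bisimulation with explicit divergence. For the converse, the class of these
    bisimulations is not obviously closed under union or composition, so
    condition (D) is weakened to: if [s R t] and [s] starts the infinite
    tau-path [f], then [t] reaches, in at least one tau-step, some state related
    to some [f k]. Together with (T) this follows from (D), and the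
    relations satisfying it are closed under union, composition and insertion of
    the intermediate states of a tau-path with related endpoints. Hence the
    largest such relation is an equivalence with the stuttering property, and
    these two facts make it a consistent, divergence preserving colouring. *)

Section ColouredEquivalence.

Context {A St : Type} (tau : A) (step : St -> A -> St -> Prop).

Notation "s ->> t" := (tau_steps tau step s t) (at level 70).

(** * Finite, nonempty and infinite tau-paths *)

Definition tau_plus (s t : St) : Prop := exists u, step s tau u /\ u ->> t.

Definition tau_path (f : nat -> St) : Prop :=
  forall k, step (f k) tau (f (k + 1)).

Lemma tau_steps_refl s : s ->> s.
Proof. apply rt_refl. Qed.

Lemma tau_steps_trans s t u : s ->> t -> t ->> u -> s ->> u.
Proof. apply rt_trans. Qed.

Lemma tau_steps_cons s t u : step s tau t -> t ->> u -> s ->> u.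
Proof. intros H; apply rt_trans; now apply rt_step. Qed.

Lemma tau_steps_inv s t : s ->> t -> s = t \/ tau_plus s t.
Proof.
  intros H; apply clos_rt_rt1n in H; destruct H as [|u t Hu Ht]; [now left|].
  right; exists u; split; [assumption|now apply clos_rt1n_rt].
Qed.

Lemma tau_plus_steps s t u : tau_plus s t -> t ->> u -> tau_plus s u.
Proof.
  intros (v & Hv & Ht) Hu; exists v; split; [assumption|].
  now apply tau_steps_trans with t.
Qed.

Lemma tau_steps_plus s t u : s ->> t -> tau_plus t u -> tau_plus s u.
Proof.
  intros Hs Hu; destruct (tau_steps_inv s t Hs) as [->|Hp]; [assumption|].
  destruct Hu as (v & Hv & Hu).
  now apply (tau_plus_steps s t u Hp), tau_steps_cons with v.
Qed.

Lemma tau_steps_opt s t u : s ->> t -> opt_step tau step t tau u -> s ->> u.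
Proof.
  intros Hs [Ht|[_ <-]]; [|assumption].
  apply tau_steps_trans with t; [assumption|now apply rt_step].
Qed.

(** Choosing a successor inside the subtype [sig P] makes it a function that can be iterated; the
    invariant [P] travels along as the second component. *)
Lemma tau_path_in (P : St -> Prop) (s : St) :
  P s -> (forall x, P x -> exists y, step x tau y /\ P y) ->
  exists g, s = g 0 /\ tau_path g /\ forall l, P (g l).
Proof.
  intros Hs H.
  pose (next := fun x : sig P =>
    let (y, Hy) := constructive_indefinite_description _ (H _ (proj2_sig x)) in
    exist P y (proj2 Hy)).
  assert (Hnext : forall x, step (proj1_sig x) tau (proj1_sig (next x))).
  { intros x; unfold next.
    destruct constructive_indefinite_description as [y Hy]; apply Hy. }
  pose (h := fun n => Nat.iter n next (exist P s Hs)).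
  exists (fun n => proj1_sig (h n)); repeat split.
  - intros k; rewrite Nat.add_1_r; apply Hnext.
  - intros l; apply proj2_sig.
Qed.

(** * Weak bisimulations and their union *)

Definition weak_divergence (R : St -> St -> Prop) : Prop :=
  forall s t f, R s t -> s = f 0 -> tau_path f ->
    exists k t', tau_plus t t' /\ R (f k) t'.

Definition weak_bisim (R : St -> St -> Prop) : Prop :=
  symmetric St R /\ transfer tau step R /\ weak_divergence R.

Definition weakly_bisimilar (s t : St) : Prop := exists R, weak_bisim R /\ R s t.

Lemma transfer_tau_steps {R s s' t} :
  transfer tau step R -> R s t -> s ->> s' -> exists t', t ->> t' /\ R s' t'.
Proof.
  intros HT Hst Hs; apply clos_rt_rt1n in Hs; revert t Hst.
  induction Hs as [s|s u s' Hu _ IH]; intros t Hst.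
  - exists t; split; [apply tau_steps_refl|assumption].
  - destruct (HT s t tau u Hst Hu) as (t'' & t' & H1 & H2 & _ & H3).
    destruct (IH t' H3) as (v & Hv & HR); exists v; split; [|assumption].
    apply tau_steps_trans with t'; [now apply tau_steps_opt with t''|assumption].
Qed.

(* If [f] leaves the states related to [t], then transferring the step that
   leaves already forces [t] to move. *)
Lemma branching_bisim_div_weak R : branching_bisim_div tau step R -> weak_bisim R.
Proof.
  intros (HS & HT & HD); split; [assumption|split; [assumption|]].
  intros s t f Hst H0 Hf.
  destruct (classic (forall k, R (f k) t)) as [Hall|Hnall].
  - destruct (HD s t f Hst H0 Hf Hall) as (g & -> & Hg & HR).
    exists 0, (g (0 + 1)); split; [|apply HR].
    exists (g (0 + 1)); split; [apply Hg|apply tau_steps_refl].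
  - apply NNPP; intros Hno; apply Hnall.
    intros k; induction k as [|k IH]; [now rewrite <- H0|].
    rewrite <- Nat.add_1_r.
    destruct (HT _ _ _ _ IH (Hf k)) as (t'' & t' & H1 & H2 & _ & H3).
    destruct (tau_steps_inv t t' (tau_steps_opt _ _ _ H1 H2)) as [->|Hp];
      [assumption|].
    exfalso; apply Hno; now exists (k + 1), t'.
Qed.

(** Each condition assumes a single related pair, so the relation witnessing that pair supplies the
    answer. Condition (D) resists this argument: its pairs [R (f k) t] could come from different
    relations. *)
Lemma weakly_bisimilar_weak_bisim : weak_bisim weakly_bisimilar.
Proof.
  split; [|split].
  - intros s t (R & HR & Hst); exists R; split; [assumption|now apply HR].
  - intros s t a s' (R & HR & Hst) Hs.
    destruct (proj1 (proj2 HR) s t a s' Hst Hs) as (t'' & t' & H1 & H2 & H3 & H4).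
    exists t'', t'; repeat split; try assumption; now exists R.
  - intros s t f (R & HR & Hst) H0 Hf.
    destruct (proj2 (proj2 HR) s t f Hst H0 Hf) as (k & t' & H1 & H2).
    exists k, t'; split; [assumption|now exists R].
Qed.

Lemma weak_bisim_eq : weak_bisim eq.
Proof.
  split; [|split].
  - intros s t; apply eq_sym.
  - intros s t a s' <- Hs; exists s, s'; repeat split; [apply tau_steps_refl|].
    now left.
  - intros s t f <- -> Hf; exists (0 + 1), (f (0 + 1)); split; [|reflexivity].
    exists (f (0 + 1)); split; [apply Hf|apply tau_steps_refl].
Qed.

(** * Closure under composition, and equivalence *)

Definition rel_comp (R1 R2 : St -> St -> Prop) (s t : St) : Prop :=
  exists u, R1 s u /\ R2 u t.

Lemma transfer_comp R1 R2 :
  transfer tau step R1 -> transfer tau step R2 ->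
  transfer tau step (rel_comp R1 R2).
Proof.
  intros HT1 HT2 s t a s' (u & Hsu & Hut) Hs.
  destruct (HT1 s u a s' Hsu Hs) as (u'' & u' & H1 & H2 & H3 & H4).
  destruct (transfer_tau_steps HT2 Hut H1) as (t1 & Ht1 & Hu1).
  destruct H2 as [H2|[-> <-]].
  - destruct (HT2 u'' t1 a u' Hu1 H2) as (t'' & t' & H5 & H6 & H7 & H8).
    exists t'', t'; repeat split; [|assumption|now exists u''|now exists u'].
    now apply tau_steps_trans with t1.
  (* The middle state does not move, so [u''] is an [R1]-partner of both [s] and [s'], and its
     [R2]-partner [t1] serves for both. *)
  - exists t1, t1; repeat split; [assumption| |now exists u''|now exists u''].
    now right.
Qed.

(* Iterating the condition for [R1] yields an infinite tau-path of states each of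
   which still reaches an [R1]-partner of some [f k]; then apply it for [R2]. *)
Lemma weak_divergence_comp R1 R2 :
  weak_divergence R1 -> transfer tau step R2 -> weak_divergence R2 ->
  weak_divergence (rel_comp R1 R2).
Proof.
  intros HD1 HT2 HD2 s t f (u & Hsu & Hut) H0 Hf.
  destruct (tau_path_in (fun v => exists k w, v ->> w /\ R1 (f k) w) u)
    as (g & Hg0 & Hg & HP).
  - exists 0, u; split; [apply tau_steps_refl|now rewrite <- H0].
  - intros v (k & w & Hvw & HR).
    destruct (HD1 (f k) w (fun i => f (k + i)) HR) as (j & w' & Hp & Hw').
    + now rewrite Nat.add_0_r.
    + intros i; rewrite Nat.add_assoc; apply Hf.
    + destruct (tau_steps_plus v w w' Hvw Hp) as (y & Hy & Hyw).
      exists y; split; [assumption|now exists (k + j), w'].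
  - destruct (HD2 u t g Hut Hg0 Hg) as (l & t' & Hp & HR).
    destruct (HP l) as (k & w & Hw & HkR).
    destruct (transfer_tau_steps HT2 HR Hw) as (t'' & Ht & Hwt).
    exists k, t''; split; [now apply tau_plus_steps with t'|now exists w].
Qed.

Lemma weakly_bisimilar_equivalence : equivalence St weakly_bisimilar.
Proof.
  destruct weakly_bisimilar_weak_bisim as (HS & HT & HD); split.
  - intros s; exists eq; split; [apply weak_bisim_eq|reflexivity].
  (* The composite of two different symmetric relations need not be symmetric, so the largest one is
     composed with itself. *)
  - intros s u t Hsu Hut; exists (rel_comp weakly_bisimilar weakly_bisimilar).
    split; [split; [|split]|now exists u].
    + intros x y (z & Hx & Hy); exists z; split; now apply HS.
    + now apply transfer_comp.
    + now apply weak_divergence_comp.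
  - exact HS.
Qed.

(** * The stuttering property *)

Definition stutter (R : St -> St -> Prop) (s t : St) : Prop :=
  exists w z, w ->> t /\ t ->> z /\ R s w /\ R s z.

(** Whichever of the two states is the intermediate one, [t] silently reaches an [R]-partner of [s]:
    either the far endpoint [z], or the answer to the path from [w] to [s]. From there the
    conditions on [R] apply. *)
Lemma weak_bisim_stutter R :
  reflexive St R -> weak_bisim R ->
  weak_bisim (fun s t => stutter R s t \/ stutter R t s).
Proof.
  intros Hrefl (HS & HT & HD).
  assert (Hincl : forall x y, R x y -> stutter R x y).
  { intros x y Hxy; exists y, y; repeat split; try assumption;
      apply tau_steps_refl. }
  assert (Hmeet : forall s t, stutter R s t \/ stutter R t s ->
    exists t', t ->> t' /\ R s t').
  { intros s t [(w & z & _ & Htz & _ & Hz)|(w & z & Hws & _ & Hw & _)].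
    - now exists z.
    - now apply (transfer_tau_steps HT (HS _ _ Hw)). }
  split; [|split].
  - intros s t [H|H]; [now right|now left].
  - intros s t a s' Hst Hs.
    destruct (Hmeet s t Hst) as (t1 & Ht1 & HR).
    destruct (HT s t1 a s' HR Hs) as (t'' & t' & H1 & H2 & H3 & H4).
    exists t'', t'; repeat split; [|assumption|left; auto|left; auto].
    now apply tau_steps_trans with t1.
  - intros s t f Hst H0 Hf.
    destruct (Hmeet s t Hst) as (t1 & Ht1 & HR).
    destruct (HD s t1 f HR H0 Hf) as (k & t' & H1 & H2).
    exists k, t'; split; [now apply tau_steps_plus with t1|left; auto].
Qed.

Lemma weakly_bisimilar_stuttering t u v :
  t ->> u -> u ->> v -> weakly_bisimilar t v -> weakly_bisimilar t u.
Proof.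
  pose proof (equiv_refl _ _ weakly_bisimilar_equivalence) as Hrefl.
  intros H1 H2 H3.
  eexists; split;
    [exact (weak_bisim_stutter _ Hrefl weakly_bisimilar_weak_bisim)|].
  left; now exists t, v.
Qed.

(** * From colourings to bisimulations *)

Lemma colour_eq (C : St -> St -> Prop) s t :
  equivalence St C -> C s t -> colour C s = colour C t.
Proof.
  intros [_ Htr Hsy] Hst; apply functional_extensionality; intros x.
  apply propositional_extensionality; split; intros H.
  - apply Htr with s; [now apply Hsy|assumption].
  - now apply Htr with t.
Qed.

Lemma colour_eq_rel (C : St -> St -> Prop) s t :
  equivalence St C -> colour C s = colour C t -> C s t.
Proof.
  intros [Hr _ _] H; change (colour C s t); rewrite H; apply Hr.
Qed.

(** The second component of [coloured_path], isolated so that inductions on paths compare only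
    contracted lists. *)
Definition trace_tail (C : St -> St -> Prop) (s : St) (p : list (A * St)) :=
  contract tau (colour C s) (map (fun x => (fst x, colour C (snd x))) p).

(** The steps of [q] contracted before the only entry are tau-steps within one colour; they form the
    silent path to [t'']. *)
Lemma trace_tail_single (C : St -> St -> Prop) t q a d :
  is_path step t q -> trace_tail C t q = [(a, d)] ->
  exists t'' t', t ->> t'' /\ colour C t'' = colour C t /\
    step t'' a t' /\ colour C t' = d.
Proof.
  revert t; induction q as [|[b y] q IH]; intros t Hq Heq; [discriminate|].
  destruct Hq as [Hb Hq]; unfold trace_tail in Heq; simpl in Heq.
  destruct excluded_middle_informative as [[-> Hy]|_].
  - rewrite <- Hy in Heq.
    destruct (IH y Hq Heq) as (t'' & t' & H1 & H2 & H3 & H4).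
    exists t'', t'; repeat split; try assumption.
    + now apply tau_steps_cons with y.
    + now rewrite H2.
  - injection Heq as -> Hd _; exists t, y; repeat split; try assumption.
    apply tau_steps_refl.
Qed.

(** A tau-step inside a class is answered by standing still. Any other step is a coloured trace with
    one entry, which [t] must share. *)
Lemma consistent_transfer (C : St -> St -> Prop) :
  colouring C -> consistent tau step C -> transfer tau step C.
Proof.
  intros HE HC s t a s' Hst Hs.
  pose proof (colour_eq C s t HE Hst) as Hcol.
  destruct (classic (a = tau /\ colour C s' = colour C s)) as [[-> Hs']|Hvis].
  - exists t, t; repeat split; [apply tau_steps_refl|now right|assumption|].
    apply colour_eq_rel; [assumption|now rewrite Hs'].
  - destruct (proj1 (HC s t Hcol (coloured_path tau C s [(a, s')])))
      as (q & Hq & Heq).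
    { exists [(a, s')]; split; [now split|reflexivity]. }
    injection Heq as _ Heq; symmetry in Heq; simpl in Heq.
    destruct excluded_middle_informative as [Hbad|_]; [contradiction|].
    destruct (trace_tail_single C t q a _ Hq Heq) as (t'' & t' & H1 & H2 & H3 & H4).
    exists t'', t'; repeat split; [assumption|now left| |].
    + apply colour_eq_rel; [assumption|now rewrite H2].
    + now apply colour_eq_rel.
Qed.

Lemma preserves_divergence_transfer (C : St -> St -> Prop) :
  colouring C -> preserves_divergence tau step C -> divergence_transfer tau step C.
Proof.
  intros HE HP s t f Hst H0 Hf Hall.
  pose proof (colour_eq C s t HE Hst) as Hcol.
  assert (Hs : divergent tau step C s).
  { exists f; repeat split; [assumption|assumption|].
    intros k; rewrite Hcol; now apply colour_eq. }
  destruct (classic (divergent tau step C t)) as [(g & Hg0 & Hg & Hgc)|Hnt].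
  - exists g; repeat split; [assumption|assumption|]; intros k l.
    apply colour_eq_rel; [assumption|rewrite Hgc; now apply colour_eq].
  - exfalso; apply HP; now exists s, t.
Qed.

(** * From the largest weak bisimulation to a colouring *)

Lemma trace_tail_prepend t u q :
  t ->> u -> weakly_bisimilar t u -> is_path step u q ->
  exists q', is_path step t q' /\
    trace_tail weakly_bisimilar t q' = trace_tail weakly_bisimilar u q.
Proof.
  pose proof weakly_bisimilar_equivalence as HE.
  intros Htu HB Hq; apply clos_rt_rt1n in Htu.
  induction Htu as [t|t y u Hy Hyu IH]; [now exists q|].
  apply clos_rt1n_rt in Hyu.
  (* By stuttering the whole silent path keeps the colour of [t], so each prepended step is
     contracted. *)
  assert (Hty : weakly_bisimilar t y).
  { apply weakly_bisimilar_stuttering with u; [now apply rt_step|assumption..]. }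
  destruct IH as (q' & Hq' & Heq); [|assumption|].
  { apply (equiv_trans _ _ HE) with t; [now apply (equiv_sym _ _ HE)|assumption]. }
  exists ((tau, y) :: q'); split; [now split|].
  rewrite <- Heq; unfold trace_tail; simpl.
  pose proof (colour_eq _ t y HE Hty) as Hc.
  destruct excluded_middle_informative as [_|Hn].
  - now rewrite Hc.
  - exfalso; now apply Hn.
Qed.

Lemma weakly_bisimilar_trace_tail s t p :
  weakly_bisimilar s t -> is_path step s p ->
  exists q, is_path step t q /\
    trace_tail weakly_bisimilar t q = trace_tail weakly_bisimilar s p.
Proof.
  pose proof weakly_bisimilar_equivalence as HE.
  destruct weakly_bisimilar_weak_bisim as (HS & HT & _).
  revert s t; induction p as [|[a s'] p IH]; intros s t Hst Hp;
    [now exists []|].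
  destruct Hp as [Hs Hp].
  destruct (HT s t a s' Hst Hs) as (t'' & t' & H1 & H2 & H3 & H4).
  destruct (IH s' t' H4 Hp) as (q & Hq & Heq).
  assert (Htt : weakly_bisimilar t t'').
  { apply (equiv_trans _ _ HE) with s; [now apply HS|assumption]. }
  pose proof (colour_eq _ s t'' HE H3) as Hc.
  pose proof (colour_eq _ s' t' HE H4) as Hc'.
  (* The silent prefix from [t] to [t''] leaves the trace unchanged, so a path from [t'']
     suffices. *)
  enough (exists r, is_path step t'' r /\
    trace_tail weakly_bisimilar t'' r =
    trace_tail weakly_bisimilar s ((a, s') :: p)) as (r & Hr & Hre).
  { destruct (trace_tail_prepend t t'' r H1 Htt Hr) as (q' & Hq' & Hqe).
    exists q'; split; [assumption|now rewrite Hqe]. }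
  destruct H2 as [H2|[-> <-]].
  (* Labels and colours agree on both sides, so the two first steps are contracted together or kept
     together. *)
  - exists ((a, t') :: q); split; [now split|].
    unfold trace_tail in *; simpl; rewrite <- Hc, <- Hc' in *.
    destruct excluded_middle_informative as [[_ He]|_].
    + now rewrite <- He.
    + now rewrite Heq.
  (* Here [s] and [s'] share the colour of [t''], so the step of [s] is contracted and [q] already
     matches. *)
  - exists q; split; [assumption|].
    unfold trace_tail in *; simpl; rewrite Heq, Hc, Hc'.
    destruct excluded_middle_informative as [_|Hn]; [reflexivity|].
    exfalso; now apply Hn.
Qed.

Lemma weakly_bisimilar_consistent : consistent tau step weakly_bisimilar.
Proof.
  pose proof weakly_bisimilar_equivalence as HE.
  enough (Hhalf : forall s t, colour weakly_bisimilar s = colour weakly_bisimilar t ->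
    forall sigma, coloured_trace tau step weakly_bisimilar s sigma ->
      coloured_trace tau step weakly_bisimilar t sigma)
    by (intros s t H sigma; split; now apply Hhalf).
  intros s t Hcol sigma (p & Hp & ->).
  destruct (weakly_bisimilar_trace_tail s t p) as (q & Hq & Heq);
    [now apply colour_eq_rel|assumption|].
  exists q; split; [assumption|].
  unfold coloured_path; f_equal; [assumption|]; now symmetry.
Qed.

(** Every state of the class of [s] has a tau-step staying in that class: weak divergence leads it
    back to the class after at least one step, and stuttering keeps the first step inside. Iteration
    gives the divergence of [t]. *)
Lemma weakly_bisimilar_preserves_divergence :
  preserves_divergence tau step weakly_bisimilar.
Proof.
  pose proof weakly_bisimilar_equivalence as HE.
  destruct weakly_bisimilar_weak_bisim as (HS & _ & HD).
  intros (s & t & (f & H0 & Hf & Hfc) & Hnt & Hcol); apply Hnt.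
  destruct (tau_path_in (fun x => weakly_bisimilar s x) t) as (g & Hg0 & Hg & HP).
  - now apply colour_eq_rel.
  - intros x Hx.
    destruct (HD s x f Hx H0 Hf) as (k & x' & (y & Hy & Hyx) & HR).
    exists y; split; [assumption|].
    apply (equiv_trans _ _ HE) with x; [assumption|].
    apply weakly_bisimilar_stuttering with x'; [now apply rt_step|assumption|].
    apply (equiv_trans _ _ HE) with s; [now apply HS|].
    apply (equiv_trans _ _ HE) with (f k); [|assumption].
    now apply colour_eq_rel.
  - exists g; repeat split; [assumption|assumption|].
    intros k; rewrite <- Hcol; symmetry; now apply colour_eq.
Qed.

End ColouredEquivalence.

Theorem theorem4 (A S : Type) (tau : A) (step : S -> A -> S -> Prop) :
  forall s t : S,
    coloured_equiv tau step s t <-> branching_bisimilar_div tau step s t.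
Proof.
  intros s t; split.
  - intros (C & HE & HC & HP & Hcol); exists C; split; [split; [|split]|].
    + apply HE.
    + now apply consistent_transfer.
    + now apply preserves_divergence_transfer.
    + now apply colour_eq_rel.
  - intros (R & HR & Hst); exists (weakly_bisimilar tau step).
    pose proof (weakly_bisimilar_equivalence tau step) as HE.
    split; [assumption|split; [|split]].
    + apply weakly_bisimilar_consistent.
    + apply weakly_bisimilar_preserves_divergence.
    + apply colour_eq; [assumption|].
      exists R; split; [now apply branching_bisim_div_weak|assumption].
Qed.
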